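(* Let $t=(t_{ij})\in\{0,1\}^{mn}$, $\gamma\in\mathbb{R}_+^m$ and $\delta\in\mathbb{R}_+^n$. For $x\in\{0,1\}^n$ and $z\in\{0,1\}^m$ define $$\phi(x,z)=\min_{y\in\mathbb{R}^{mn}}\ \sum_{i=1}^m\sum_{j=1}^n c_{ij}y_{ij}$$ subject to $$\sum_{j=1}^n t_{ij}y_{ij}\le s_i-\gamma_i z_i\ \ (i=1,\dots,m),\qquad \sum_{i=1}^m t_{ij}y_{ij}\ge d_j+\delta_j x_j\ \ (j=1,\dots,n),\qquad 0\le y_{ij}\le f_{ij}\ \ (\text{all } i,j).$$ Then $\phi(x,z)$ is supermodular (jointly in $(x,z)$) for all $c$, $s$, $d$ and $f$.
   Context: A function $\phi$ on a sublattice $X\subseteq\mathbb{R}^N$ is supermodular if $\phi(u')+\phi(u'')\le\phi(u'\vee u'')+\phi(u'\wedge u'')$ for all $u',u''\in X$, with $\vee,\wedge$ the componentwise maximum and minimum. This is the capacitated facility location model with $m$ facilities with capacities $s_i$, $n$ demand sites with demands $d_j$, unit costs $c_{ij}$, and flow capacities $f_{ij}$; $z_i=1$ reduces the capacity of facility $i$ by $\gamma_i$ and $x_j=1$ increases the demand of site $j$ by $\delta_j$. Standing assumption (complete recourse): parameters are such that for every $(x,z)$ the minimization problem is feasible and bounded; ''for all $c,s,d,f$'' ranges over such parameters. *)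

(* Defs.v *)
From mathcomp Require Import all_boot all_order all_algebra.
From mathcomp Require Import boolp classical_sets reals.

Set Implicit Arguments.
Unset Strict Implicit.
Unset Printing Implicit Defensive.

Import Order.TTheory GRing.Theory Num.Theory.
Local Open Scope classical_set_scope.
Local Open Scope ring_scope.

Section Supermodularity.
Variables (R : realType) (N : nat).
Implicit Types (u v : 'rV[R]_N) (X : set 'rV[R]_N).

Definition vjoin u v : 'rV[R]_N := \row_k Num.max (u 0 k) (v 0 k).
Definition vmeet u v : 'rV[R]_N := \row_k Num.min (u 0 k) (v 0 k).

Definition sublattice X : Prop :=
  forall u v, X u -> X v -> X (vjoin u v) /\ X (vmeet u v).

Definition supermodular X (phi : 'rV[R]_N -> R) : Prop :=
  forall u v, X u -> X v ->
    phi u + phi v <= phi (vjoin u v) + phi (vmeet u v).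

Definition binary_vectors : set 'rV[R]_N :=
  [set u | forall k, u 0 k = 0 \/ u 0 k = 1].

Lemma sublattice_binary_vectors : sublattice binary_vectors.
Proof.
move=> u v Xu Xv; split=> k; rewrite mxE.
  by case: (leP (u 0 k) (v 0 k)).
by case: (leP (u 0 k) (v 0 k)).
Qed.

End Supermodularity.

(* The minimum of V, and 0 when V has no least element. *)
Definition min_value (R : realType) (V : set R) : R := xget 0 (V `&` lbound V).

Lemma min_value_eq (R : realType) (V : set R) (v : R) :
  V v -> lbound V v -> min_value V = v.
Proof.
move=> Vv lv; apply: xget_unique => // w [Vw lw].
by apply/eqP; rewrite eq_le lw// lv.
Qed.

Section FacilityLocation.
Variables (R : realType) (m n : nat).
Variables (t : 'M[R]_(m, n)) (gamma : 'rV[R]_m) (delta : 'rV[R]_n).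
Variables (c : 'M[R]_(m, n)) (s : 'rV[R]_m) (d : 'rV[R]_n) (f : 'M[R]_(m, n)).
Implicit Types (x : 'rV[R]_n) (z : 'rV[R]_m) (y : 'M[R]_(m, n)).

Definition feasible x z : set 'M[R]_(m, n) := [set y |
  [/\ forall i, \sum_j t i j * y i j <= s 0 i - gamma 0 i * z 0 i,
      forall j, \sum_i t i j * y i j >= d 0 j + delta 0 j * x 0 j &
      forall i j, 0 <= y i j <= f i j]].

Definition cost y : R := \sum_i \sum_j c i j * y i j.

Definition costs x z : set R := cost @` feasible x z.

Definition facility_value x z : R := min_value (costs x z).

(* [has_inf] : the problem is feasible and its objective is bounded below. *)
Definition complete_recourse : Prop := forall x z,
  binary_vectors x -> binary_vectors z -> has_inf (costs x z).

(* A joint argument (x, z) is the concatenated vector u = row_mx x z. *)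
Definition facility_value_joint (u : 'rV[R]_(n + m)) : R :=
  facility_value (lsubmx u) (rsubmx u).

End FacilityLocation.

(* Main.v *)
Require Import Defs.
From mathcomp Require Import all_boot all_order all_algebra.
From mathcomp Require Import boolp classical_sets reals.
From mathcomp Require Import topology normedtype derive.
From mathcomp Require Import ring lra.
Import Order.TTheory GRing.Theory Num.Theory.
Import numFieldNormedType.Exports.
Local Open Scope ring_scope.

(** The proof is an exchange argument. Let P and Q be optimal at the join and at
    the meet of u and v. It suffices to find a matrix E such that Q + E is
    feasible at u and P - E is feasible at v: the two costs then add up to
    cost P + cost Q, and they bound the values at u and v from above.

    Read D = P - Q, restricted to the cells with t i j = 1, as a flow in the
    bipartite graph of facilities and sites: a positive entry flows from row to
    column, a negative one from column to row. P meets the tightest capacity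
    and demand at every node, and Q the loosest. At a row that is a source of D,
    P uses at least as much capacity as Q, so both fit the tight capacity and any
    share of the row's excess may be moved from P to Q; likewise at a column
    that is a source. At a sink the constraint does bind, but all is well if E
    takes the whole deficit when u has the tight constraint there, and nothing
    when v has it. So E must be a part of the flow D that ends exactly at a
    prescribed set of sinks and starts anywhere.

    Such a part exists ([flow_splitting]) because flow can be routed by
    proportional mixing: if p v is the fraction of the flow through v that ends
    in a prescribed sink, the part is F v w * p w on the edge from v to w. The
    fractions are absorption probabilities, that is, a solution of a monotone
    fixed-point equation on a cube ([absorption_probability]), and the
    Knaster-Tarski argument provides one ([box_fixpoint]); cycles of the flow
    need no separate treatment.

    Both gamma >= 0 and delta >= 0 enter in making the join the tightest and the
    meet the loosest problem. The optimal solutions used above exist because a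
    feasible region is a compact polytope ([facility_value_attained]). *)

(** * Splitting a flow by its sinks *)

(** Knaster-Tarski on the cube: the pointwise supremum of the points p with
    p <= G p is the greatest fixed point. *)
Lemma box_fixpoint (R : realType) (V : Type) (G : (V -> R) -> V -> R) :
    (forall p q, (forall v, p v <= q v) -> forall v, G p v <= G q v) ->
    (forall p, (forall v, 0 <= p v <= 1) -> forall v, 0 <= G p v <= 1) ->
  exists2 p, forall v, 0 <= p v <= 1 & forall v, G p v = p v.
Proof.
move=> Gmono Gbox.
pose S p := (forall v, 0 <= p v <= 1) /\ forall v, p v <= G p v.
pose T v := [set r : R | exists2 p, S p & r = p v]%classic.
pose P v := sup (T v).
have S0 : S (fun=> 0).
  split=> v; first by rewrite lexx ler01.
  by have /andP[] := Gbox (fun=> 0) (fun=> introT andP (conj (lexx _) ler01)) v.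
have T0 v : (T v !=set0)%classic by exists 0, (fun=> 0).
have Tub v : ubound (T v) 1 by move=> _ [p [pbox _] ->]; case/andP: (pbox v).
have leP p v : S p -> p v <= P v.
  by move=> Sp; apply: ub_le_sup; [exists 1; exact: Tub | exists p].
have Pbox v : 0 <= P v <= 1.
  by rewrite (leP _ _ S0) /= ge_sup.
have PG v : P v <= G P v.
  apply: ge_sup => // _ [p Sp ->].
  apply: (le_trans (Sp.2 v)); apply: Gmono => w; exact: leP.
exists P => // v; apply: le_anti; rewrite PG andbT.
apply: (leP (G P)); split; first exact: Gbox.
by move=> w; exact: Gmono.
Qed.

(** Let the flow F leave the network at v with rate k v. A particle that follows
    the flow moves from v to w with probability proportional to F v w, and exits
    at v with probability proportional to k v; then p v is the probability of
    exiting in tau, and the equation is conditioning on the first step. The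
    equation is multiplied out to cover the nodes that no flow leaves. *)
Lemma absorption_probability (R : realType) (V : finType) (F : V -> V -> R)
    (k : V -> R) (tau : pred V) :
    (forall v w, 0 <= F v w) -> (forall v, 0 <= k v) ->
  exists2 p : V -> R, forall v, 0 <= p v <= 1 &
    forall v, p v * (\sum_w F v w + k v) =
              \sum_w F v w * p w + (tau v)%:R * k v.
Proof.
move=> F0 k0.
pose T v := \sum_w F v w + k v.
pose H (p : V -> R) v := \sum_w F v w * p w + (tau v)%:R * k v.
have T0 v : 0 <= T v by rewrite addr_ge0 ?sumr_ge0.
have Hle p v : (forall v, 0 <= p v <= 1) -> 0 <= H p v <= T v.
  move=> pbox; apply/andP; split.
    rewrite addr_ge0 ?mulr_ge0 ?ler0n ?sumr_ge0 // => w _.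
    by rewrite mulr_ge0 //; case/andP: (pbox w).
  rewrite lerD ?ler_sum // => [w _|].
    by rewrite ler_piMr //; case/andP: (pbox w).
  by rewrite ler_piMl // lern1 leq_b1.
(* Where T v = 0, the convention x / 0 = 0 keeps the iteration in the cube. *)
have [|p pbox|p pbox pE] := @box_fixpoint R V (fun p v => H p v / T v).
- move=> p q pq v; rewrite ler_wpM2r ?invr_ge0 // lerD2r ler_sum // => w _.
  by rewrite ler_wpM2l.
- move=> v; have /andP[H0 HT] := Hle p v pbox.
  rewrite divr_ge0 //=; have [Tv0|Tv0] := eqVneq (T v) 0.
    by rewrite Tv0 invr0 mulr0 ler01.
  by rewrite ler_pdivrMr ?mul1r // lt_def Tv0 T0.
exists p => // v; rewrite -/(T v) -/(H p v) -pE.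
have [Tv0|Tv0] := eqVneq (T v) 0; last by rewrite divfK.
by apply: le_anti; have := Hle p v pbox; rewrite Tv0 mulr0.
Qed.

Definition net {R : realType} {V : finType} (F : V -> V -> R) v :=
  \sum_w F v w - \sum_w F w v.

(** The part E of the flow that ends in the sinks of tau: each unit on the edge
    from v to w belongs to it in proportion p w, the fraction of the flow
    through w that will end in tau. The sinks are the nodes of negative net
    outflow. *)
Lemma flow_splitting (R : realType) (V : finType) (F : V -> V -> R)
    (tau : pred V) :
    (forall v w, 0 <= F v w) ->
  exists E : V -> V -> R,
    [/\ forall v w, 0 <= E v w <= F v w,
        forall v, 0 <= net F v -> 0 <= net E v <= net F v &
        forall v, net F v <= 0 -> net E v = (tau v)%:R * net F v].
Proof.
move=> F0; pose k v := Num.max 0 (- net F v).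
have k0 v : 0 <= k v by rewrite le_max lexx.
have [p pbox pE] := @absorption_probability R V F k tau F0 k0.
have netE v : net (fun v w => F v w * p w) v =
    p v * (net F v + k v) - (tau v)%:R * k v.
  rewrite /net -mulr_suml.
  by have := pE v; set a := \sum_w _ * _; set b := _%:R * _; nra.
exists (fun v w => F v w * p w); split=> [v w|v|v] /=.
- by case/andP: (pbox w) => p0 p1; rewrite mulr_ge0 // ler_piMr.
- move=> n0; rewrite netE; have -> : k v = 0 by apply/max_idPl; rewrite oppr_le0.
  by case/andP: (pbox v) => p0 p1; rewrite addr0 mulr0 subr0 mulr_ge0 // ler_piMl.
- move=> n0; rewrite netE.
  have -> : k v = - net F v by apply/max_idPr; rewrite oppr_ge0.
  by rewrite subrr mulr0 mulrN opprK add0r.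
Qed.

(** [flow_splitting] on the complete bipartite graph of rows and columns.
    Positive entries are edges from rows to columns and negative entries edges
    back, so the sinks are the rows of negative sum and the columns of positive
    sum. *)
Lemma conformal_submatrix (R : realType) (m n : nat) (D : 'M[R]_(m, n))
    (I : pred 'I_m) (J : pred 'I_n) :
  exists E : 'M[R]_(m, n),
    [/\ forall i j, Num.min 0 (D i j) <= E i j <= Num.max 0 (D i j),
        forall i, 0 <= \sum_j D i j -> 0 <= \sum_j E i j <= \sum_j D i j,
        forall i, \sum_j D i j <= 0 -> \sum_j E i j = (I i)%:R * \sum_j D i j,
        forall j, \sum_i D i j <= 0 -> \sum_i D i j <= \sum_i E i j <= 0 &
        forall j, 0 <= \sum_i D i j -> \sum_i E i j = (J j)%:R * \sum_i D i j].
Proof.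
pose F (v w : 'I_m + 'I_n) : R := match v, w with
  | inl i, inr j => Num.max 0 (D i j)
  | inr j, inl i => Num.max 0 (- D i j)
  | _, _ => 0 end.
have F0 v w : 0 <= F v w by case: v w => [i|j] [i'|j'] //=; rewrite le_max lexx.
pose tau (v : 'I_m + 'I_n) := match v with inl i => I i | inr j => J j end.
have [E [EF Epos Eneg]] := @flow_splitting R _ F tau F0.
pose E' := \matrix_(i, j) (E (inl i) (inr j) - E (inr j) (inl i)).
have Ell i i' : E (inl i) (inl i') = 0.
  by apply: le_anti; rewrite andbC; exact: (EF (inl i) (inl i')).
have Err j j' : E (inr j) (inr j') = 0.
  by apply: le_anti; rewrite andbC; exact: (EF (inr j) (inr j')).
have netFl i : net F (inl i) = \sum_j D i j.
  rewrite /net !big_sumType /= !big1_eq !add0r -sumrB; apply: eq_bigr => j _.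
  by case: (leP 0 (D i j)); case: (leP 0 (- D i j)) => /=; lra.
have netFr j : net F (inr j) = - \sum_i D i j.
  rewrite /net !big_sumType /= !big1_eq !addr0 -sumrB -sumrN.
  by apply: eq_bigr => i _; case: (leP 0 (D i j)); case: (leP 0 (- D i j)) => /=; lra.
have netEl i : net E (inl i) = \sum_j E' i j.
  rewrite /net !big_sumType /=.
  rewrite (eq_bigr (fun=> 0)) // big1_eq.
  rewrite [X in _ - (X + _)](eq_bigr (fun=> 0)) // big1_eq.
  by rewrite !add0r -sumrB; apply: eq_bigr => j _; rewrite mxE.
have netEr j : net E (inr j) = - \sum_i E' i j.
  rewrite /net !big_sumType /=.
  rewrite [X in _ + X - _](eq_bigr (fun=> 0)) // big1_eq.
  rewrite [X in _ - (_ + X)](eq_bigr (fun=> 0)) // big1_eq.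
  by rewrite !addr0 -sumrB -sumrN; apply: eq_bigr => i _; rewrite mxE opprB.
exists E'; split=> [i j|i|i|j|j].
- rewrite mxE; have := EF (inl i) (inr j); have := EF (inr j) (inl i) => /=.
  by case: (leP 0 (D i j)); case: (leP 0 (- D i j)) => /= *; apply/andP; split; lra.
- by rewrite -netEl -netFl; exact: Epos.
- by rewrite -netEl -netFl; exact: Eneg.
- move=> D0; have := Epos (inr j); rewrite netFr netEr oppr_ge0 => /(_ D0).
  by rewrite oppr_ge0 lerN2 andbC.
- move=> D0; have := Eneg (inr j); rewrite netFr netEr oppr_le0 => /(_ D0).
  by rewrite mulrN => /oppr_inj.
Qed.

(** * Existence of optimal solutions *)

Lemma vec_mx_continuous (R : realType) (m n : nat) (i : 'I_m) (j : 'I_n) :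
  continuous (fun v : 'rV[R]_(m * n) => vec_mx v i j : R).
Proof.
rewrite (_ : (fun v => _) = (fun v : 'rV[R]_(m * n) => v 0 (mxvec_index i j))).
  exact: coord_continuous.
by apply/funext => v; rewrite mxE.
Qed.

Lemma wsum_continuous (R : realType) (T : topologicalType) (I : finType)
    (a : I -> R) (g : I -> T -> R) :
  (forall i, continuous (g i)) -> continuous (fun v => \sum_i a i * g i v).
Proof.
move=> gc; apply: continuous_big => [|i _ v]; first exact: add_continuous.
by apply: (@continuousM _ _ (fun=> a i)); [exact: cst_continuous | exact: gc].
Qed.

Lemma closed_comp_le (R : realType) (T : topologicalType) (g : T -> R) (b : R) :
  continuous g -> closed [set v | g v <= b]%classic.
Proof. by move=> /continuous_closedP gcl; exact: (gcl _ (@closed_le R b)). Qed.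

Lemma closed_comp_ge (R : realType) (T : topologicalType) (g : T -> R) (b : R) :
  continuous g -> closed [set v | b <= g v]%classic.
Proof. by move=> /continuous_closedP gcl; exact: (gcl _ (@closed_ge R b)). Qed.

Lemma closed_forall (T : topologicalType) (I : Type) (P : I -> set T) :
  (forall i, closed (P i)) -> closed [set v | forall i, P i v]%classic.
Proof.
move=> Pcl; rewrite (_ : mkset _ = \bigcap_i P i)%classic.
  by apply: closed_bigI => i _.
by apply/seteqP; split=> v Pv i; [move=> _; exact: Pv | exact: Pv].
Qed.

(** The flow bounds make the feasible region a closed part of a box, hence
    compact, and the cost is continuous. Matrices are flattened to row vectors,
    where a product of segments is known to be compact. *)
Lemma facility_value_attained (R : realType) (m n : nat)
    (t : 'M[R]_(m, n)) (gamma : 'rV[R]_m) (delta : 'rV[R]_n)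
    (c : 'M[R]_(m, n)) (s : 'rV[R]_m) (d : 'rV[R]_n) (f : 'M[R]_(m, n))
    (x : 'rV[R]_n) (z : 'rV[R]_m) :
  (feasible t gamma delta s d f x z !=set0)%classic ->
  exists y, [/\ feasible t gamma delta s d f x z y,
    facility_value t gamma delta c s d f x z = cost c y &
    forall y', feasible t gamma delta s d f x z y' -> cost c y <= cost c y'].
Proof.
move=> [y0 y0feas].
suff [y yfeas ymin] : exists2 y, feasible t gamma delta s d f x z y &
    forall y', feasible t gamma delta s d f x z y' -> cost c y <= cost c y'.
  exists y; split=> //; apply: min_value_eq; first by exists y.
  by move=> _ [y' y'feas <-]; exact: ymin.
pose box := [set v : 'rV[R]_(m * n) |
  forall k, `[0, mxvec f 0 k]%classic (v 0 k)]%classic.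
pose rows := [set v : 'rV[R]_(m * n) | forall i,
  \sum_j t i j * vec_mx v i j <= s 0 i - gamma 0 i * z 0 i]%classic.
pose cols := [set v : 'rV[R]_(m * n) | forall j,
  d 0 j + delta 0 j * x 0 j <= \sum_i t i j * vec_mx v i j]%classic.
pose A := (box `&` (rows `&` cols))%classic.
have AP v : A v <-> feasible t gamma delta s d f x z (vec_mx v).
  split=> [[vbox [vr vc]]|[vr vc vbox]]; split=> //.
    move=> i j; rewrite mxE.
    by have := vbox (mxvec_index i j); rewrite /= in_itv /= mxvecE.
  move=> k; case/mxvec_indexP: k => i j.
  by have := vbox i j; rewrite mxE /= in_itv /= mxvecE.
have Aco : compact A.
  apply: compact_closedI.
    apply: (@rV_compact R _ (fun k => `[0, mxvec f 0 k]%classic)) => k.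
    exact: segment_compact.
  apply: closedI; apply: closed_forall => k.
    apply: (@closed_comp_le R _ (fun v => \sum_j t k j * vec_mx v k j)).
    by apply: wsum_continuous => j; exact: vec_mx_continuous.
  apply: (@closed_comp_ge R _ (fun v => \sum_i t i k * vec_mx v i k)).
  by apply: wsum_continuous => i; exact: vec_mx_continuous.
have [||v vA vmin] := @EVT_min_rV R _ (fun v => cost c (vec_mx v)) A _ Aco.
- by exists (mxvec y0); apply/AP; rewrite mxvecK.
- apply: continuous_subspaceT; apply: continuous_big => [|i _].
    exact: add_continuous.
  by apply: wsum_continuous => j; exact: vec_mx_continuous.
exists (vec_mx v) => [|y yfeas]; first by apply/AP; rewrite inE in vA.
by have := vmin (mxvec y); rewrite mxvecK; apply; rewrite inE; apply/AP; rewrite mxvecK.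
Qed.

(** * Exchange between two transportation plans *)

(** Since the tight problem may change from node to node, the minima and maxima
    play the part of the join and the meet. At a node where P - Q is a sink, only
    E equal to the whole deficit or to 0 is sure to respect both bounds, which is
    why the split by sinks is called for. *)

Lemma transport_exchange (R : realType) (m n : nat) (t : 'M[R]_(m, n))
    (ht : forall i j, t i j = 0 \/ t i j = 1)
    (a1 a2 : 'I_m -> R) (b1 b2 : 'I_n -> R) (P Q : 'M[R]_(m, n)) :
    (forall i, \sum_j t i j * P i j <= Num.min (a1 i) (a2 i)) ->
    (forall i, \sum_j t i j * Q i j <= Num.max (a1 i) (a2 i)) ->
    (forall j, Num.max (b1 j) (b2 j) <= \sum_i t i j * P i j) ->
    (forall j, Num.min (b1 j) (b2 j) <= \sum_i t i j * Q i j) ->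
  exists E : 'M[R]_(m, n),
    [/\ forall i j, Num.min 0 (P i j - Q i j) <= E i j
                      <= Num.max 0 (P i j - Q i j),
        forall i, \sum_j t i j * (Q + E) i j <= a1 i /\
                  \sum_j t i j * (P - E) i j <= a2 i &
        forall j, b1 j <= \sum_i t i j * (Q + E) i j /\
                  b2 j <= \sum_i t i j * (P - E) i j].
Proof.
move=> Pr Qr Pc Qc.
pose D := \matrix_(i, j) (t i j * (P i j - Q i j)).
(* A deficit is taken whole exactly where the first problem is the tight one. *)
have [E [Ebox Erp Ern Ecn Ecp]] := @conformal_submatrix R m n D
  (fun i => a1 i <= a2 i) (fun j => b2 j <= b1 j).
(* E vanishes where t does, since D does, so t drops out of the sums of E. *)
have tE i j : t i j * E i j = E i j.
  case: (ht i j) => tij; rewrite tij ?mul1r //.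
  have := Ebox i j; rewrite mxE tij !mul0r minxx maxxx => ?.
  by symmetry; apply: le_anti; rewrite andbC.
have QEr i : \sum_j t i j * (Q + E) i j = \sum_j t i j * Q i j + \sum_j E i j.
  by rewrite -big_split; apply: eq_bigr => j _; rewrite mxE mulrDr tE.
have PEr i : \sum_j t i j * (P - E) i j = \sum_j t i j * P i j - \sum_j E i j.
  by rewrite -sumrB; apply: eq_bigr => j _; rewrite !mxE mulrBr tE.
have QEc j : \sum_i t i j * (Q + E) i j = \sum_i t i j * Q i j + \sum_i E i j.
  by rewrite -big_split; apply: eq_bigr => i _; rewrite mxE mulrDr tE.
have PEc j : \sum_i t i j * (P - E) i j = \sum_i t i j * P i j - \sum_i E i j.
  by rewrite -sumrB; apply: eq_bigr => i _; rewrite !mxE mulrBr tE.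
have Dr i : \sum_j D i j = \sum_j t i j * P i j - \sum_j t i j * Q i j.
  by rewrite -sumrB; apply: eq_bigr => j _; rewrite mxE mulrBr.
have Dc j : \sum_i D i j = \sum_i t i j * P i j - \sum_i t i j * Q i j.
  by rewrite -sumrB; apply: eq_bigr => i _; rewrite mxE mulrBr.
exists E; split=> [i j|i|j].
- have := Ebox i j; rewrite mxE; case: (ht i j) => ->; rewrite ?mul1r //.
  rewrite mul0r minxx maxxx => /andP[E0 E1].
  by rewrite ge_min E0 le_max E1.
- rewrite QEr PEr; have := Pr i; have := Qr i; have := Erp i; have := Ern i.
  rewrite Dr; set p := \sum_j _ * P i j; set q := \sum_j _ * Q i j.
  have [pq|/ltW pq] := leP 0 (p - q).
    by move=> _ /(_ isT) /andP[]; case: (leP (a1 i)) => /= *; split; lra.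
  move=> /(_ pq) -> _; case: (leP (a1 i)) => /= *; split; lra.
- rewrite QEc PEc; have := Pc j; have := Qc j; have := Ecp j; have := Ecn j.
  rewrite Dc; set p := \sum_i _ * P i j; set q := \sum_i _ * Q i j.
  have [pq|/ltW pq] := leP (p - q) 0.
    by move=> /(_ isT) /andP[] + + _; case: (leP (b2 j) (b1 j)) => /= *; split; lra.
  move=> _ /(_ pq) ->; case: (leP (b2 j) (b1 j)) => /= *; split; lra.
Qed.

(** * Supermodularity *)

Theorem proposition3 (R : realType) (m n : nat)
    (t : 'M[R]_(m, n)) (gamma : 'rV[R]_m) (delta : 'rV[R]_n)
    (ht : forall i j, t i j = 0 \/ t i j = 1)
    (hgamma : forall i, 0 <= gamma 0 i)
    (hdelta : forall j, 0 <= delta 0 j) :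
  forall (c : 'M[R]_(m, n)) (s : 'rV[R]_m) (d : 'rV[R]_n) (f : 'M[R]_(m, n)),
    complete_recourse t gamma delta c s d f ->
    supermodular (@binary_vectors R (n + m))
      (facility_value_joint t gamma delta c s d f).
Proof.
move=> c s d f recourse u v Bu Bv.
have attained w : binary_vectors w -> exists y,
    [/\ feasible t gamma delta s d f (lsubmx w) (rsubmx w) y,
        facility_value_joint t gamma delta c s d f w = cost c y &
        forall y', feasible t gamma delta s d f (lsubmx w) (rsubmx w) y' ->
          cost c y <= cost c y'].
  move=> Bw; apply: facility_value_attained.
  have [||[_ [y yfeas _]] _] := recourse (lsubmx w) (rsubmx w).
  - by move=> k; rewrite mxE; exact: Bw.
  - by move=> k; rewrite mxE; exact: Bw.
  - by exists y.
have [Bj Bm] := sublattice_binary_vectors Bu Bv.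
have [yu [_ -> umin]] := attained u Bu.
have [yv [_ -> vmin]] := attained v Bv.
have [P [[Pr Pc Pbox] -> _]] := attained _ Bj.
have [Q [[Qr Qc Qbox] -> _]] := attained _ Bm.
pose cap (w : 'rV[R]_(n + m)) i := s 0 i - gamma 0 i * rsubmx w 0 i.
pose dem (w : 'rV[R]_(n + m)) j := d 0 j + delta 0 j * lsubmx w 0 j.
have [||||E [Ebox Er Ec]] :=
    @transport_exchange R m n t ht (cap u) (cap v) (dem u) (dem v) P Q.
- move=> i; apply: (le_trans (Pr i)); rewrite /cap !mxE.
  by rewrite le_min !lerD2l !lerN2 !ler_wpM2l // le_max lexx ?orbT.
- move=> i; apply: (le_trans (Qr i)); rewrite /cap !mxE minElt.
  by case: ifP => _; rewrite le_max lexx ?orbT.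
- move=> j; apply: (le_trans _ (Pc j)); rewrite /dem !mxE.
  by rewrite ge_max !lerD2l !ler_wpM2l // le_max lexx ?orbT.
- move=> j; apply: (le_trans _ (Qc j)); rewrite /dem !mxE [in leRHS]minElt.
  by case: ifP => _; rewrite ge_min lexx ?orbT.
have -> : cost c P + cost c Q = cost c (Q + E) + cost c (P - E).
  rewrite /cost -!big_split; apply: eq_bigr => i _.
  by rewrite -!big_split; apply: eq_bigr => j _; rewrite !mxE /=; ring.
(* Both entries lie between P i j and Q i j, because E is conformal to P - Q. *)
have box i j : 0 <= (Q + E) i j <= f i j /\ 0 <= (P - E) i j <= f i j.
  have := Pbox i j; have := Qbox i j; have := Ebox i j; rewrite !mxE.
  by case: (leP 0 (P i j - Q i j)) => /= *; split; lra.
apply: lerD; [apply: umin | apply: vmin]; split=> [i|j|i j].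
- exact: (Er i).1.
- exact: (Ec j).1.
- exact: (box i j).1.
- exact: (Er i).2.
- exact: (Ec j).2.
- exact: (box i j).2.
Qed.
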